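(* If $n\geq 2$ is even, then $$\left(\frac{12B_{\frac{n+2}{2}}^{neobc}-4C_{\frac{n+2}{2}}^{neobc}-6}{6},\ \frac{12B_{\frac{n+2}{2}}^{neobc}-4C_{\frac{n+2}{2}}^{neobc}-12}{6},\ \frac{-16B_{\frac{n+2}{2}}^{neobc}+6C_{\frac{n+2}{2}}^{neobc}+12}{6}\right)$$ is a Pythagorean triple, and if $n\geq1$ is odd, then $(a,b,c)$ is a Pythagorean triple, where $$a=\frac{20B_{\frac{n+3}{2}}^{neobc}+4B_{\frac{n+1}{2}}^{neobc}-7C_{\frac{n+3}{2}}^{neobc}-C_{\frac{n+1}{2}}^{neobc}-12}{12},$$ $$b=\frac{20B_{\frac{n+3}{2}}^{neobc}+4B_{\frac{n+1}{2}}^{neobc}-7C_{\frac{n+3}{2}}^{neobc}-C_{\frac{n+1}{2}}^{neobc}-24}{12},$$ $$c=\frac{20B_{\frac{n+3}{2}}^{neobc}-4B_{\frac{n+1}{2}}^{neobc}-7C_{\frac{n+3}{2}}^{neobc}+C_{\frac{n+1}{2}}^{neobc}-12}{6}.$$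
   Context: A Pythagorean triple is a triple $(a,b,c)$ of positive integers with $a^2+b^2=c^2$. A positive integer $m$ is a neo balcobalancing number if there is a positive integer $r$ such that $(1+2+\cdots+(m-1))+(1+2+\cdots+m)=2[(m-1)+m+(m+1)+(m+2)+\cdots+(m+r)]$ (equivalently, $8m^2-12m+9$ is a perfect square). $B_k^{neobc}$ is the $k$-th neo balcobalancing number in increasing order ($k\ge1$) and $C_k^{neobc}=\sqrt{8(B_k^{neobc})^2-12B_k^{neobc}+9}$. *)

(* Defs.v *)
From HB Require Import structures.
From mathcomp Require Import all_boot all_order all_algebra.
From mathcomp Require Import boolp reals.
From mathcomp Require Import zify.

Set Implicit Arguments.
Unset Strict Implicit.
Unset Printing Implicit Defensive.

Import Order.TTheory GRing.Theory Num.Theory.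

Definition neo_balcobalancing (m : nat) : Prop :=
  0 < m /\
  exists r, 0 < r /\
    \sum_(1 <= i < m) i + \sum_(1 <= i < m.+1) i
    = 2 * \sum_(m.-1 <= i < (m + r).+1) i.

Lemma double_sum_nat a k :
  2 * \sum_(a <= i < a + k) i + k = k * (a.*2 + k).
Proof.
elim: k => [|k IHk]; first by rewrite !addn0 big_geq.
rewrite (addnS a) big_nat_recr ?leq_addr //=.
by move: IHk; set S := \sum_(_ <= _ < _) _; nia.
Qed.

Lemma neo_balcobalancing_eq m r : 0 < m ->
  \sum_(1 <= i < m) i + \sum_(1 <= i < m.+1) i
    = 2 * \sum_(m.-1 <= i < (m + r).+1) i
  <-> m * m + (r + 2) = (r + 2) * (m.*2 + r).
Proof.
case: m => // m _ /=.
have := double_sum_nat 1 m; have := double_sum_nat 1 m.+1.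
have := double_sum_nat m (r + 2).
rewrite !add1n (_ : m + (r + 2) = (m.+1 + r).+1); last by lia.
set x := \sum_(m <= _ < _) _; set y := \sum_(1 <= _ < m.+1) _.
set z := \sum_(1 <= _ < m.+2) _.
by move=> hx hz hy; split=> h; nia.
Qed.

Lemma neo_balcobalancing_unbounded N :
  exists m, (N < m) && `[< neo_balcobalancing m >].
Proof.
suff [m [r [Nm r0 E]]] : exists m r,
    [/\ N < m, 0 < r & m * m + (r + 2) = (r + 2) * (m.*2 + r)].
  exists m; rewrite Nm /=; apply/asboolP; split; first by lia.
  by exists r; split => //; apply/neo_balcobalancing_eq => //; lia.
elim: N => [|N [m [r [Nm r0 E]]]]; first by exists 6, 1.
by exists (29 * m + 12 * r - 6), (12 * m + 5 * r - 4); split; nia.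
Qed.

(* [neobc_B k] is the k-th neo balcobalancing number for k >= 1; the value
   at 0 only starts the recursion and is not a neo balcobalancing number. *)
Fixpoint neobc_B (k : nat) : nat :=
  if k is k'.+1 then ex_minn (neo_balcobalancing_unbounded (neobc_B k'))
  else 0.

Lemma neobc_B_lt k : neobc_B k < neobc_B k.+1.
Proof. by rewrite /=; case: ex_minnP => m /andP[]. Qed.

Lemma neobc_B_neo k : 0 < k -> neo_balcobalancing (neobc_B k).
Proof. by case: k => //= k _; case: ex_minnP => m /andP[_ /asboolP]. Qed.

Lemma neobc_B_onto m :
  neo_balcobalancing m -> exists2 k, 0 < k & neobc_B k = m.
Proof.
move=> hm; have m0 : 0 < m by case: hm.
suff H k : m <= neobc_B k -> exists2 j, 0 < j & neobc_B j = m.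
  apply: (H m); elim: {hm m0 H} m => // m IH.
  exact: leq_ltn_trans IH (neobc_B_lt m).
elim: k => [/=|k IHk mk]; first by lia.
have [/IHk //|km] := leqP m (neobc_B k); exists k.+1 => //.
apply/eqP; rewrite eqn_leq mk andbT /=.
by case: ex_minnP => p _; apply; rewrite km; apply/asboolP.
Qed.

Local Open Scope ring_scope.

Definition neobc_C (R : realType) (k : nat) : R :=
  Num.sqrt (8 * (neobc_B k)%:R ^+ 2 - 12 * (neobc_B k)%:R + 9).

Definition pythagorean_triple (R : realType) (a b c : R) : Prop :=
  [/\ a \is a Num.int /\ 0 < a,
      b \is a Num.int /\ 0 < b,
      c \is a Num.int /\ 0 < c
    & a ^+ 2 + b ^+ 2 = c ^+ 2].

(* Main.v *)
(* The defining equation with r is m^2 + (r+2) = (r+2)(2m+r), whose solutions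
   are the orbit of (6, 1) under
   (m, r) |-> (29m + 12r - 6, 12m + 5r - 4): the inverse map decreases m and
   keeps solutions with m >= 180 positive, and (6, 1) is the only solution
   below 180. Along the orbit 3 divides m and r - 1, so m = 3x and r = 3y + 1
   with x^2 = (y+1)(2x+y), while C = 2m + 2r + 1 is an integer. Substituting,
   the two triples become (10x+4y+1, 10x+4y, 14x+6y+1) and
   (2x, 2x-1, 2x+2y+1), where (x, y) comes from the orbit point with index
   one less than that of the largest B involved. *)
Require Import Defs.
From HB Require Import structures.
From mathcomp Require Import all_boot all_order all_algebra.
From mathcomp Require Import boolp reals.
From mathcomp Require Import zify ring lra.

Import Order.TTheory GRing.Theory Num.Theory.
Local Open Scope ring_scope.

(** The orbit map rewritten through [m = 3x], [r = 3y + 1]; the start [(6, 1)] becomes [(2, 0)]. *)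
Fixpoint orbit_xy (k : nat) : nat * nat :=
  if k is k'.+1 then
    let: (x, y) := orbit_xy k' in
    (29 * x + 12 * y + 2, 12 * x + 5 * y)%N
  else (2, 0)%N.

Definition orbit_x k := (orbit_xy k).1.
Definition orbit_y k := (orbit_xy k).2.

Lemma orbit_xS k : orbit_x k.+1 = (29 * orbit_x k + 12 * orbit_y k + 2)%N.
Proof. by rewrite /orbit_x /orbit_y /=; case: orbit_xy. Qed.

Lemma orbit_yS k : orbit_y k.+1 = (12 * orbit_x k + 5 * orbit_y k)%N.
Proof. by rewrite /orbit_x /orbit_y /=; case: orbit_xy. Qed.

Lemma orbit_x_gt1 k : (1 < orbit_x k)%N.
Proof. by elim: k => // k IHk; rewrite orbit_xS; lia. Qed.

Lemma orbit_eq k :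
  (orbit_x k * orbit_x k =
   (orbit_y k + 1) * (2 * orbit_x k + orbit_y k))%N.
Proof.
elim: k => // k; rewrite orbit_xS orbit_yS.
by move: (orbit_x k) (orbit_y k) => x y; nia.
Qed.

Lemma orbit_x_lt : {homo orbit_x : j k / (j < k)%N}.
Proof.
by apply: homo_ltn => [|k]; [exact: ltn_trans | rewrite orbit_xS; lia].
Qed.

Lemma orbit_x_le j k : (j <= k)%N -> (orbit_x j <= orbit_x k)%N.
Proof. by rewrite leq_eqVlt => /predU1P[->//|/orbit_x_lt/ltnW]. Qed.

(** For [m < 180] and [r >= 75] the right side exceeds the left, so only a finite check remains. *)
Lemma small_solution m r :
  (0 < m < 180)%N -> (0 < r)%N ->
  (m * m + (r + 2) = (r + 2) * (m.*2 + r))%N -> m = 6%N /\ r = 1%N.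
Proof.
move=> /andP[m0 m180] r0 E.
have rm : (r < 75)%N by nia.
have : all (fun m => all (fun r =>
    (m * m + (r + 2) == (r + 2) * (m.*2 + r))%N ==> (m == 6%N) && (r == 1%N))
    (iota 1 74)) (iota 1 179) by vm_compute.
move=> /allP/(_ m); rewrite mem_iota => /(_ ltac:(lia)).
move=> /allP/(_ r); rewrite mem_iota => /(_ ltac:(lia)).
by rewrite E eqxx /= => /andP[/eqP-> /eqP->].
Qed.

Lemma solution_in_orbit m r :
  (0 < m)%N -> (0 < r)%N ->
  (m * m + (r + 2) = (r + 2) * (m.*2 + r))%N ->
  exists k, m = (3 * orbit_x k)%N /\ r = (3 * orbit_y k + 1)%N.
Proof.
elim/ltn_ind: m r => m IH r m0 r0 E.
(* The cut is at [180 = 29 * 6 + 12 * 1 - 6], the orbit point after 6. *)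
have [m180|m180] := ltnP m 180.
  by have [||-> ->] := small_solution m r _ _ E; [lia|lia|exists 0%N].
(* These bounds keep the subtractions in [m'] and [r'] from truncating; the first also yields
   [m' < m]. The linear part of the orbit map has determinant [29 * 5 - 12 * 12 = 1], so its inverse
   is integral. *)
have ltr : (12 * m < 29 * r + 44)%N by nia.
have ltm : (12 * r + 18 < 5 * m)%N by nia.
pose m' := (5 * m - (12 * r + 18))%N; pose r' := (29 * r + 44 - 12 * m)%N.
have Em : m = (29 * m' + 12 * r' - 6)%N by lia.
have Er : r = (12 * m' + 5 * r' - 4)%N by lia.
have m'0 : (0 < m')%N by lia.
have r'0 : (0 < r')%N by lia.
have [||||k [hm hr]] := IH m' _ r' => //; first by lia.
  by move: (m') (r') m'0 r'0 Em Er E {IH ltr ltm} => a b *; subst; nia.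
by exists k.+1; rewrite orbit_xS orbit_yS; lia.
Qed.

Lemma neo_balcobalancing_orbit m :
  neo_balcobalancing m <-> exists k, m = (3 * orbit_x k)%N.
Proof.
split=> [[m0 [r [r0 /(neo_balcobalancing_eq r m0) E]]]|[k ->]].
  by have [k [? _]] := solution_in_orbit _ _ m0 r0 E; exists k.
have x0 := orbit_x_gt1 k.
split; first by lia.
exists (3 * orbit_y k + 1)%N; split; first by lia.
apply/neo_balcobalancing_eq; first by lia.
by have := orbit_eq k; move: (orbit_x k) (orbit_y k) => x y; nia.
Qed.

(** Since [orbit_x] is strictly increasing and [3 * orbit_x] takes exactly the neo balcobalancing
    values, the least one above a given orbit value is the next. *)
Lemma neobc_B_orbit k : neobc_B k.+1 = (3 * orbit_x k)%N.
Proof.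
elim: k => [|k IHk]; rewrite [LHS]/=; case: ex_minnP => m.
  move=> /andP[_ /asboolP/neo_balcobalancing_orbit[j ->]] /(_ 6).
  have -> : `[< neo_balcobalancing 6 >].
    by apply/asboolP/neo_balcobalancing_orbit; exists 0%N.
  by move=> /(_ isT); have := orbit_x_le 0 j isT; rewrite /(orbit_x 0) /=; lia.
rewrite -[ex_minn _]/(neobc_B k.+1) IHk.
move=> /andP[ltkm /asboolP/neo_balcobalancing_orbit[j Em]].
have ltkj : (k < j)%N.
  by rewrite ltnNge; apply/negP => /orbit_x_le; lia.
have := orbit_x_le _ _ ltkj; have ltx := orbit_x_lt _ _ (ltnSn k).
move=> lexj /(_ (3 * orbit_x k.+1)%N).
have -> : `[< neo_balcobalancing (3 * orbit_x k.+1) >].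
  by apply/asboolP/neo_balcobalancing_orbit; exists k.+1.
by rewrite andbT => /(_ ltac:(lia)); lia.
Qed.

Lemma orbit_eqr (R : realType) k (x := (orbit_x k)%:R : R)
    (y := (orbit_y k)%:R : R) :
  x ^+ 2 = (y + 1) * (2 * x + y).
Proof.
by have /(congr1 (GRing.natmul (1 : R))) := orbit_eq k; rewrite !(natrM, natrD).
Qed.

Lemma neobc_C_orbit (R : realType) k :
  neobc_C R k.+1 = 6 * (orbit_x k)%:R + 6 * (orbit_y k)%:R + 3.
Proof.
rewrite /neobc_C neobc_B_orbit natrM.
have := orbit_eqr R k; have := ler0n R (orbit_x k).
have := ler0n R (orbit_y k).
move: (orbit_x k)%:R (orbit_y k)%:R => x y y0 x0 E.
have -> : 8 * (3 * x) ^+ 2 - 12 * (3 * x) + 9 = (6 * x + 6 * y + 3) ^+ 2.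
  by ring: E.
by rewrite sqrtr_sqr ger0_norm //; lra.
Qed.

Lemma pythagorean_triple_nat (R : realType) (a b c : nat) :
  (0 < a)%N -> (0 < b)%N -> (0 < c)%N -> (a * a + b * b = c * c)%N ->
  pythagorean_triple (a%:R : R) b%:R c%:R.
Proof.
move=> a0 b0 c0 E; rewrite /pythagorean_triple !ltr0n a0 b0 c0.
by split; rewrite ?natr_int // !expr2 -!natrM -natrD E.
Qed.

Theorem theorem7p1 (R : realType) (n : nat) :
  ((2 <= n)%N -> ~~ odd n ->
    let B : R := (neobc_B ((n + 2) %/ 2))%:R in
    let C : R := neobc_C R ((n + 2) %/ 2) in
    pythagorean_triple
      ((12 * B - 4 * C - 6) / 6)
      ((12 * B - 4 * C - 12) / 6)
      ((- 16 * B + 6 * C + 12) / 6))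
  /\
  ((1 <= n)%N -> odd n ->
    let B3 : R := (neobc_B ((n + 3) %/ 2))%:R in
    let B1 : R := (neobc_B ((n + 1) %/ 2))%:R in
    let C3 : R := neobc_C R ((n + 3) %/ 2) in
    let C1 : R := neobc_C R ((n + 1) %/ 2) in
    pythagorean_triple
      ((20 * B3 + 4 * B1 - 7 * C3 - C1 - 12) / 12)
      ((20 * B3 + 4 * B1 - 7 * C3 - C1 - 24) / 12)
      ((20 * B3 - 4 * B1 - 7 * C3 + C1 - 12) / 6)).
Proof.
split=> n0 n_odd.
  have [k ->] : exists k, ((n + 2) %/ 2 = k.+2)%N.
    by exists ((n - 2) %/ 2)%N; lia.
  rewrite /= neobc_C_orbit -/(neobc_B k.+2) neobc_B_orbit orbit_xS orbit_yS.
  have := orbit_x_gt1 k; have := orbit_eq k.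
  move: (orbit_x k) (orbit_y k) => x y E x1.
  (* After cancellation the Pythagorean identity is 4 times [E]; the same holds for the odd case. *)
  have := @pythagorean_triple_nat R (10 * x + 4 * y + 1) (10 * x + 4 * y)
    (14 * x + 6 * y + 1) ltac:(lia) ltac:(lia) ltac:(lia) ltac:(nia).
  by congr (pythagorean_triple _ _ _); rewrite !(natrD, natrM); field.
have [k [-> ->]] : exists k, ((n + 3) %/ 2 = k.+2 /\ (n + 1) %/ 2 = k.+1)%N.
  by exists ((n - 1) %/ 2)%N; lia.
move=> B3 B1 C3 C1.
rewrite /B3 /B1 /C3 /C1 !neobc_C_orbit !neobc_B_orbit orbit_xS orbit_yS.
have := orbit_x_gt1 k; have := orbit_eq k.
move: (orbit_x k) (orbit_y k) => x y E x1.
have := @pythagorean_triple_nat R (2 * x) (2 * x - 1)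
  (2 * x + 2 * y + 1) ltac:(lia) ltac:(lia) ltac:(lia) ltac:(nia).
(* The leg [2 * x - 1] was a truncated subtraction, exact because [1 < x]. *)
rewrite natrB; last by lia.
by congr (pythagorean_triple _ _ _); rewrite !(natrD, natrM); field.
Qed.
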